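(* Let $[\boldsymbol D,\boldsymbol o]$ be a unimodular discrete space. For any two equivariant weight functions $\boldsymbol w_1$ and $\boldsymbol w_2$, if $\mathbb E[\boldsymbol w_1(\boldsymbol o)]<\infty$ and $\boldsymbol w_2(\cdot)$ is non-degenerate a.s., then $$\underline{\mathrm{growth}}(\boldsymbol w_1(N_r(\boldsymbol o)))\le\overline{\mathrm{growth}}(\boldsymbol w_2(N_r(\boldsymbol o))),\quad\text{a.s.}$$ In particular, if $\boldsymbol w_1(N_r(\boldsymbol o))$ and $\boldsymbol w_2(N_r(\boldsymbol o))$ have well-defined growth rates, then their growth rates are equal.
   Context: A discrete space is a metric space $D$ in which every closed ball $N_r(v)=\{u\in D:d(u,v)\le r\}$ is finite; by convention $N_0(v)=\emptyset$. $\mathcal D_*$ (resp. $\mathcal D_{**}$) is the set of discrete spaces with one (resp. two) distinguished points modulo isometries preserving the distinguished points, with its natural Borel structure (local Gromov–Hausdorff topology); $[D,o]$ denotes the class of $(D,o)$. If points (or pairs of points) carry marks in a complete separable metric space $\Xi$, one gets the analogous space $\mathcal D'_*$ of classes $[D,o;m]$ modulo mark-preserving pointed isometries. A random pointed (marked) discrete space $[\boldsymbol D,\boldsymbol o]$ is unimodular if the mass transport principle holds: for every measurable $g\ge0$ on doubly pointed (marked) spaces, $\mathbb E\big[\sum_{v\in\boldsymbol D}g(\boldsymbol D,\boldsymbol o,v)\big]=\mathbb E\big[\sum_{v\in\boldsymbol D}g(\boldsymbol D,v,\boldsymbol o)\big]$. An equivariant process $\boldsymbol Z$ with values in $\Xi$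 assigns to each (deterministic) discrete space $D$ a random marking $\boldsymbol Z_D:D\to\Xi$ (extra randomness is allowed) such that (a) for every isometry $\rho:D_1\to D_2$, $\boldsymbol Z_{D_2}\circ\rho$ has the same law as $\boldsymbol Z_{D_1}$, and (b) for every measurable $A\subseteq\mathcal D'_*$, the map $[D,o]\mapsto\mathbb P([D,o;\boldsymbol Z_D]\in A)$ is measurable. When a random $[\boldsymbol D,\boldsymbol o]$ is fixed, it suffices to define $\boldsymbol Z$ on almost every realization, and $\boldsymbol Z_{\boldsymbol D}$ is sampled conditionally on $\boldsymbol D$. An equivariant weight function $\boldsymbol w$ is an equivariant process with values in $\mathbb R^{\ge0}$; $\boldsymbol w(v):=\boldsymbol w_D(v)$ and $\boldsymbol w(S):=\sum_{v\in S}\boldsymbol w(v)$ for $S\subseteq D$. It is non-degenerate a.s. if $\mathbb P[\exists v\in\boldsymbol D:\boldsymbol w_{\boldsymbol D}(v)\neq0]=1$. For $f\ge0$, the upper and lower growth rates are $\overline{\mathrm{growth}}(f(r)):=\limsup_{r\to\infty}\log f(r)/\log r$ and $\underline{\mathrm{growth}}(f(r)):=\liminf_{r\to\infty}\log f(r)/\log r$. The growth rate is well defined if these two coincide, and it is then their common value.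
   Formalization: The ''in particular'' clause is stated with the hypotheses for both weights (both E[w_i(o)] finite, both w_i non-degenerate a.s.); with the one-sided hypotheses it is false, e.g. w_1 = 0, w_2 = 1 on Z. *)

(* Defs.v *)
From HB Require Import structures.
From mathcomp Require Import all_boot all_order all_algebra.
From mathcomp Require Import all_classical all_reals all_analysis.
From mathcomp Require Import measurable_realfun.

Set Implicit Arguments.
Unset Strict Implicit.
Unset Printing Implicit Defensive.

Import Order.TTheory GRing.Theory Num.Theory.
Import numFieldNormedType.Exports.

Local Open Scope classical_set_scope.
Local Open Scope ring_scope.
Local Open Scope quotient_scope.

(* A field of type metricType R would put this record in a universe too large
   for the structures of the library; the metricType structure is therefore
   derived from the fields. *)
Record discreteSpace (R : realType) := DiscreteSpace {
  dcarrier :> Type;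
  ddist : dcarrier -> dcarrier -> R;
  ddistxx : forall x, ddist x x = 0;
  ddist_positivity : forall x y, ddist x y = 0 -> x = y;
  ddist_sym : forall x y, ddist x y = ddist y x;
  ddist_triangle : forall y x z, ddist x z <= ddist x y + ddist y z;
  finite_closed_ball : forall (v : dcarrier) (r : R),
    finite_set [set u | ddist v u <= r] }.

HB.instance Definition _ (R : realType) (D : discreteSpace R) :=
  gen_eqMixin (dcarrier D).
HB.instance Definition _ (R : realType) (D : discreteSpace R) :=
  gen_choiceMixin (dcarrier D).
HB.instance Definition _ (R : realType) (D : discreteSpace R) :=
  isMetric.Build R (dcarrier D) (@ddistxx R D) (@ddist_positivity R D)
    (@ddist_sym R D) (@ddist_triangle R D).

(* The condition 0 < r encodes the convention that N_0(v) is empty. *)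
Definition Nball (R : realType) (D : discreteSpace R) (r : R) (v : D) : set D :=
  [set u | 0 < r /\ mdist v u <= r].

Definition is_isometry (R : realType) (D1 D2 : discreteSpace R)
    (f : D1 -> D2) : Prop :=
  bijective f /\ forall x y, mdist (f x) (f y) = mdist x y.

(* A discrete space with marks in Xi and k + 1 distinguished points; the point
   of index 0 is the root, around which spaces are compared. *)
Record pspace (R : realType) (Xi : Type) (k : nat) := PSpace {
  pdspace :> discreteSpace R;
  ppoint : 'I_k.+1 -> pdspace;
  pmark : pdspace -> Xi }.

HB.instance Definition _ (R : realType) (Xi : Type) (k : nat) :=
  gen_eqMixin (pspace R Xi k).
HB.instance Definition _ (R : realType) (Xi : Type) (k : nat) :=
  gen_choiceMixin (pspace R Xi k).

Definition pisometric (R : realType) (Xi : Type) (k : nat)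
    (X Y : pspace R Xi k) : Prop :=
  exists f : X -> Y, [/\ is_isometry f,
    (forall i, f (ppoint X i) = ppoint Y i) &
    (forall x, pmark (f x) = pmark x)].

Section isometry_classes.
Context (R : realType) (Xi : Type) (k : nat).
Implicit Types X Y Z : pspace R Xi k.

Let pisob X Y : bool := `[< pisometric X Y >].

Lemma pisometric_refl : reflexive pisob.
Proof. by move=> X; apply/asboolP; exists id; split=> //; split=> //; exists id. Qed.

Lemma pisometric_sym : symmetric pisob.
Proof.
suff S X Y : pisometric X Y -> pisometric Y X.
  by move=> X Y; apply/asboolP/asboolP; exact: S.
case=> f [[[g fK gK] fd] fp fm]; exists g; split.
- by split; [exists f | move=> x y; rewrite -fd !gK].
- by move=> i; rewrite -fp fK.
- by move=> x; rewrite -fm gK.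
Qed.

Lemma pisometric_trans : transitive pisob.
Proof.
move=> Y X Z /asboolP[f [[fb fd] fp fm]] /asboolP[g [[gb gd] gp gm]].
apply/asboolP; exists (g \o f); split=> [|i|x] /=.
- by split; [exact: bij_comp | move=> x y /=; rewrite gd fd].
- by rewrite fp gp.
- by rewrite gm fm.
Qed.

Canonical pisometric_equiv :=
  EquivRel pisob pisometric_refl pisometric_sym pisometric_trans.

Definition pclass := {eq_quot pisometric_equiv}%qT.
HB.instance Definition _ := Choice.on pclass.
HB.instance Definition _ := Quotient.on pclass.

Definition pclass_of X : pclass := \pi_pclass X.
Definition prepr (c : pclass) : pspace R Xi k := repr c.

End isometry_classes.

Section local_Gromov_Hausdorff.
Context (R : realType) (Xi : pseudoPMetricType R) (k : nat).
Implicit Types X Y : pspace R Xi k.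

(* The balls of radius 1 / e around the roots are matched, up to an error e on
   distances and marks, by a correspondence which matches the distinguished
   points. *)
Definition lgh_close (e : R) X Y : Prop :=
  exists C : X -> Y -> Prop, [/\
    (forall i, C (ppoint X i) (ppoint Y i)),
    (forall x, mdist (ppoint X ord0) x <= e^-1 -> exists y, C x y),
    (forall y, mdist (ppoint Y ord0) y <= e^-1 -> exists x, C x y),
    (forall x y x' y', C x y -> C x' y' -> `|mdist x x' - mdist y y'| < e) &
    (forall x y, C x y -> ball (pmark x) e (pmark y))].

Lemma lgh_close_le (e e' : R) X Y : 0 < e -> e <= e' ->
  lgh_close e X Y -> lgh_close e' X Y.
Proof.
move=> e0 ee' [C [Cp CX CY Cd Cm]]; exists C.
have e'0 : 0 < e' by exact: lt_le_trans ee'.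
have ie : e'^-1 <= e^-1 by rewrite lef_pV2 ?posrE.
split=> //.
- by move=> x /le_trans /(_ ie) /CX.
- by move=> y /le_trans /(_ ie) /CY.
- by move=> x y x' y' /Cd h /h /lt_le_trans; apply.
- by move=> x y /Cm; apply: le_ball.
Qed.

Definition lgh_open : set (set (pclass R Xi k)) :=
  [set U | forall X, U (pclass_of X) ->
    exists2 e : R, 0 < e & forall Y, lgh_close e X Y -> U (pclass_of Y)].

Let lgh_openT : lgh_open setT.
Proof. by move=> X _; exists 1. Qed.

Let lgh_openI : setI_closed lgh_open.
Proof.
move=> U V oU oV X [/oU[e e0 eU] /oV[e' e'0 eV]].
exists (Num.min e e'); first by rewrite lt_min e0.
have m0 : 0 < Num.min e e' by rewrite lt_min e0.
move=> Y XY; split; [apply: eU | apply: eV];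
  by apply: lgh_close_le XY => //; rewrite ge_min lexx ?orbT.
Qed.

Let lgh_open_bigU (I : Type) (F : I -> set (pclass R Xi k)) :
  (forall i, lgh_open (F i)) -> lgh_open (\bigcup_i F i).
Proof.
move=> oF X [i _ /oF[e e0 eF]].
by exists e => // Y /eF FY; exists i.
Qed.

HB.instance Definition _ := isOpenTopological.Build (pclass R Xi k)
  lgh_openT lgh_openI lgh_open_bigU.

End local_Gromov_Hausdorff.

(* Unmarked spaces are spaces with marks in a one-point metric space. *)
Definition no_mark (R : realType) : Type := unit.

Section one_point.
Context (R : realType).
HB.instance Definition _ := Choice.copy (no_mark R) unit.
HB.instance Definition _ := isPointed.Build (no_mark R) tt.

Let dist (x y : no_mark R) : R := 0.
Let distxx x : dist x x = 0. Proof. by []. Qed.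
Let dist_pos x y : dist x y = 0 -> x = y. Proof. by case: x y => -[]. Qed.
Let dist_sym x y : dist x y = dist y x. Proof. by []. Qed.
Let dist_tri y x z : dist x z <= dist x y + dist y z.
Proof. by rewrite /dist addr0. Qed.
Let dist_fin (v : no_mark R) (r : R) : finite_set [set u | dist v u <= r].
Proof. exact: (@finite_finset unit). Qed.

HB.instance Definition _ :=
  isMetric.Build R (no_mark R) distxx dist_pos dist_sym dist_tri.

Definition one_point_space : discreteSpace R :=
  DiscreteSpace distxx dist_pos dist_sym dist_tri dist_fin.
End one_point.

HB.instance Definition _ (R : realType) (Xi : pseudoPMetricType R) (k : nat) :=
  isPointed.Build (pclass R Xi k)
    (pclass_of (@PSpace R Xi k (one_point_space R) (fun=> tt)
      (fun=> point))).

(* Isometry classes with the Borel sigma-algebra of the local Gromov-Hausdorff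
   topology: Dstar for D_*, Dstar2 for D_**, Dmarked Xi for D'_*. *)
Notation borel_pclass R Xi k :=
  (g_sigma_algebraType (@open (pclass R Xi k))).
Notation Dstar R := (borel_pclass R (no_mark R) 0).
Notation Dstar2 R := (borel_pclass R (no_mark R) 1).
Notation Dmarked R Xi := (borel_pclass R Xi 0).

Section classes.
Context (R : realType).

Definition birooted (D : discreteSpace R) (o v : D) : Dstar2 R :=
  pclass_of (@PSpace R (no_mark R) 1 D (fun i => if i == ord0 then o else v)
    (fun=> tt)).

Definition marked (Xi : pseudoPMetricType R) (D : discreteSpace R) (o : D)
    (m : D -> Xi) : Dmarked R Xi :=
  pclass_of (@PSpace R Xi 0 D (fun=> o) m).

(* A representative (dspace c, droot c) of the class c in D_*. *)
Definition dspace (c : Dstar R) : discreteSpace R := prepr c.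
Definition droot (c : Dstar R) : dspace c := ppoint (prepr c) ord0.

End classes.

(* mu is the law of the random pointed discrete space [D, o]. *)
Definition unimodular (R : realType) (mu : probability (Dstar R) R) : Prop :=
  forall g : Dstar2 R -> \bar R,
    measurable_fun [set: Dstar2 R] g -> (forall x, (0 <= g x)%E) ->
    (\int[mu]_c (\esum_(v in [set: dspace c]) g (birooted (droot c) v)) =
     \int[mu]_c (\esum_(v in [set: dspace c]) g (birooted v (droot c))))%E.

Section equivariant_processes.
Context (R : realType).

(* The product sigma-algebra on D -> Xi. *)
Definition marking_measurable (D : Type) (Xi : topologicalType) :
    set (set (D -> Xi)) :=
  <<s [set C | exists (v : D) (U : set Xi), open U /\ C = [set m | U (m v)]] >>.

(* For each D, (Omega D, P D) is the probability space carrying the (extra)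
   randomness, and Z D is a random marking defined on it. Several processes can
   live on the same spaces, with any coupling. *)
Context (d : discreteSpace R -> measure_display)
  (Omega : forall D, measurableType (d D))
  (P : forall D, probability (Omega D) R).

Definition equivariant_process (Xi : pseudoPMetricType R)
    (Z : forall D : discreteSpace R, Omega D -> D -> Xi) : Prop :=
  [/\ (forall (D : discreteSpace R) (S : set (D -> Xi)),
        marking_measurable S -> measurable (Z D @^-1` S)),
      (forall (D1 D2 : discreteSpace R) (rho : D1 -> D2), is_isometry rho ->
        forall S : set (D1 -> Xi), marking_measurable S ->
        P D2 [set omega | S (Z D2 omega \o rho)] = P D1 (Z D1 @^-1` S)) &
      (forall A : set (Dmarked R Xi), measurable A ->
        measurable_fun [set: Dstar R] (fun c : Dstar R =>
          P (dspace c) [set omega | A (marked (droot c) (Z (dspace c) omega))]))].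

(* Marks are taken in R with nonnegativity required separately; the Borel
   subsets of D'_* for nonnegative marks are the traces of those for real marks
   since the nonnegative reals are closed in R. *)
Definition equivariant_weight
    (w : forall D : discreteSpace R, Omega D -> D -> R) : Prop :=
  equivariant_process w /\ forall D omega v, 0 <= w D omega v.

Context (mu : probability (Dstar R) R).

(* [D, o] has law mu and, given D, omega is sampled from P D. *)
Definition almost_surely (Q : forall c : Dstar R, Omega (dspace c) -> Prop) :
    Prop :=
  {ae mu, forall c, {ae P (dspace c), forall omega, Q c omega}}.

Definition expected_root_weight
    (w : forall D : discreteSpace R, Omega D -> D -> R) : \bar R :=
  (\int[mu]_c \int[P (dspace c)]_omega (w (dspace c) omega (droot c))%:E)%E.

Definition nondegenerate_weight
    (w : forall D : discreteSpace R, Omega D -> D -> R) : Prop :=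
  almost_surely (fun c omega => exists v, w (dspace c) omega v != 0).

(* r |-> w(N_r(o)) *)
Definition ball_weight (w : forall D : discreteSpace R, Omega D -> D -> R)
    (c : Dstar R) (omega : Omega (dspace c)) (r : R) : \bar R :=
  (\esum_(v in Nball r (droot c)) (w (dspace c) omega v)%:E)%E.

End equivariant_processes.

(* lne is the extended logarithm, with lne 0 = -oo. *)
Definition upper_growth (R : realType) (f : R -> \bar R) : \bar R :=
  limf_esup (fun r => lne (f r) / (ln r)%:E)%E (pinfty_nbhs R).

Definition lower_growth (R : realType) (f : R -> \bar R) : \bar R :=
  limf_einf (fun r => lne (f r) / (ln r)%:E)%E (pinfty_nbhs R).

Definition growth_well_defined (R : realType) (f : R -> \bar R) : Prop :=
  lower_growth f = upper_growth f.

(* Main.v *)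
(* Since w1 and w2 need not be jointly equivariant, w1 is replaced by its mean
   W1(x) = E[w1(x)], a measurable function of the pointed space. With open balls
   B_r, let each x send the mass W1(x) E[w2(y) / w2(B_2r(y))] to every y in
   B_r(x). As B_r(x) is contained in B_2r(y), x sends at most W1(x) in total, so
   the mass received by the root, E[w2(o) / w2(B_2r(o))] W1(B_r(o)), has
   expectation at most E[w1(o)]. By Fatou its liminf over the radii r = n is
   a.s. finite at the root, hence, by unimodularity, at all points v of D. With
   A_n = 1 + W1(B_n(v)), a second use of Fatou, given D, shows that
   w1(B_n(v)) / A_n + w2(v) A_n / w2(B_2n(v)) is bounded along a subsequence.
   Taking v with w2(v) > 0 and multiplying the two terms, w1(B_n(v)) is at most
   a constant times w2(B_2n(v)) for infinitely many n, which bounds the lower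
   growth rate of w1 by the upper growth rate of w2. *)
Require Import Defs.
From HB Require Import structures.
From mathcomp Require Import all_boot all_order all_algebra.
From mathcomp Require Import all_classical all_reals all_analysis.
From mathcomp Require Import measurable_realfun ring lra.

Set Implicit Arguments.
Unset Strict Implicit.
Unset Printing Implicit Defensive.

Import Order.TTheory GRing.Theory Num.Theory.
Import numFieldNormedType.Exports.

Local Open Scope classical_set_scope.
Local Open Scope ring_scope.

Lemma esum_subset (R : realType) (T : choiceType) (A B : set T) (f : T -> \bar R) :
  A `<=` B -> (forall x, B x -> (0 <= f x)%E) ->
  (\esum_(i in A) f i <= \esum_(i in B) f i)%E.
Proof.
move=> AB f0; rewrite esum_mkcond [leRHS]esum_mkcond; apply: le_esum => i _.
case: ifPn => [|_]; first by rewrite !inE => /AB Bi; rewrite mem_set.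
by case: ifPn => //; rewrite inE => /f0.
Qed.

Lemma esum_enum (R : realType) (T : choiceType) (t : T) (A : set T)
    (f : T -> \bar R) : finite_set A -> (forall x, A x -> (0 <= f x)%E) ->
  \esum_(i in A) f i =
  (\sum_(i < size (finmap.enum_fset (fset_set A)))
    f (nth t (finmap.enum_fset (fset_set A)) i))%E.
Proof.
move=> fA f0; rewrite esum_fset//; last by move=> i; rewrite inE => /f0.
by rewrite fsbig_finite//= (big_nth t) big_mkord.
Qed.

Lemma common_radius (R : realType) (T : choiceType) (A : set T)
    (P : T -> R -> Prop) : finite_set A ->
  (forall x, A x -> exists2 e : R, 0 < e & forall e', 0 < e' <= e -> P x e') ->
  exists2 e : R, 0 < e & forall e' x, 0 < e' <= e -> A x -> P x e'.
Proof.
move=> fA AP; suff [e e0 eP] : exists2 e : R, 0 < e & forall e' x, 0 < e' <= e ->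
    x \in (finmap.enum_fset (fset_set A)) -> P x e'.
  by exists e => // e' x e'e Ax; apply: eP => //; rewrite in_fset_set// inE.
have {}AP x : x \in (finmap.enum_fset (fset_set A)) ->
    exists2 e : R, 0 < e & forall e', 0 < e' <= e -> P x e'.
  by rewrite in_fset_set// inE => /AP.
elim: {fA A}(finmap.enum_fset (fset_set A)) AP => [|a s IH] AP; first by exists 1.
have [|e e0 eP] := IH; first by move=> x xs; apply: AP; rewrite inE xs orbT.
have [|e1 e10 e1P] := AP a; first by rewrite inE eqxx.
exists (Num.min e e1); first by rewrite lt_min e0.
move=> e' x /andP[e'0]; rewrite le_min => /andP[e'e e'e1].
rewrite inE => /orP[/eqP ->|xs]; first by apply: e1P; rewrite e'0.
by apply: eP => //; rewrite e'0.
Qed.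

(** * Pointed spaces and the local Gromov-Hausdorff topology *)

Section rerooting.
Context (R : realType).
Implicit Types Xi : pseudoPMetricType R.

Definition lgh_correspondence Xi k (e : R) (X Y : pspace R Xi k)
    (C : X -> Y -> Prop) : Prop :=
  [/\ (forall i, C (ppoint X i) (ppoint Y i)),
    (forall x, mdist (ppoint X ord0) x <= e^-1 -> exists y, C x y),
    (forall y, mdist (ppoint Y ord0) y <= e^-1 -> exists x, C x y),
    (forall x y x' y', C x y -> C x' y' -> `|mdist x x' - mdist y y'| < e) &
    (forall x y, C x y -> ball (pmark x) e (pmark y))].

Definition reroot (Xi : Type) k (X : pspace R Xi k) (x : X) : pspace R Xi 0 :=
  @PSpace R Xi 0 X (fun=> x) (@pmark _ _ _ X).

Lemma pclass_ofP (Xi : Type) k (X Y : pspace R Xi k) :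
  pclass_of X = pclass_of Y <-> pisometric X Y.
Proof.
split=> [/eqmodP/asboolP //|XY].
by apply/eqmodP; apply/asboolP.
Qed.

Lemma prepr_pclass_of (Xi : Type) k (X : pspace R Xi k) :
  pisometric (prepr (pclass_of X)) X.
Proof. by apply/(pclass_ofP (prepr _)); rewrite [LHS]reprK. Qed.

Lemma pclass_of_prepr (Xi : Type) k (c : pclass R Xi k) :
  pclass_of (prepr c) = c.
Proof. exact: reprK. Qed.

Lemma reroot_isometric (Xi : Type) k (X Y : pspace R Xi k) (f : X -> Y) x :
  is_isometry f -> (forall z, pmark (f z) = pmark z) ->
  pisometric (reroot x) (reroot (f x)).
Proof. by move=> fi fm; exists f. Qed.

Lemma reroot_point (Xi : Type) (X : pspace R Xi 0) :
  pclass_of (reroot (ppoint X ord0)) = pclass_of X.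
Proof.
apply/pclass_ofP; exists id; split=> //; first by split=> //; exists id.
by move=> i /=; rewrite (ord1 i).
Qed.

Lemma reroot_close Xi k (e0 e : R) (X Y : pspace R Xi k) C x y :
  0 < e -> e <= 1 -> e <= e0 -> mdist (ppoint X ord0) x + 1 + e0^-1 <= e^-1 ->
  @lgh_correspondence Xi k e X Y C -> C x y ->
  lgh_close e0 (reroot x) (reroot y).
Proof.
move=> ep e1 ee0 de [Cp CX CY Cd Cm] Cxy.
have dY : mdist (ppoint Y ord0) y <= mdist (ppoint X ord0) x + 1.
  have := Cd _ _ _ _ (Cp ord0) Cxy.
  by rewrite ltr_distlC => /andP[_ /ltW/le_trans]; apply; rewrite lerD2l.
exists C; split=> //=.
- move=> x' xx'; apply: CX; apply: le_trans (metric_triangle _ x _) _.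
  apply: le_trans de; rewrite lerD//.
  by rewrite lerDl.
- move=> y' yy'; apply: CY; apply: le_trans (metric_triangle _ y _) _.
  by apply: le_trans de; rewrite lerD.
- by move=> *; apply: lt_le_trans ee0; apply: Cd.
- by move=> x' y' /Cm; apply: le_ball.
Qed.

(* The constant 1 leaves room for the distortion e <= 1 of the distance to the
   new root. *)
Lemma close_radius (d e0 : R) : 0 < e0 -> 0 <= d ->
  exists2 e : R, 0 < e & forall e', 0 < e' <= e ->
    [/\ e' <= 1, e' <= e0 & d + 1 + e0^-1 <= e'^-1].
Proof.
move=> e00 d0; have p0 : 0 < d + 1 + e0^-1.
  by rewrite addr_gt0 ?invr_gt0// ltr_wpDl.
exists (Num.min 1 (Num.min e0 (d + 1 + e0^-1)^-1)).
  by rewrite !lt_min ltr01 e00 invr_gt0.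
move=> e' /andP[e'0]; rewrite !le_min => /and3P[-> -> h]; split=> //.
by rewrite -[leLHS]invrK lef_pV2 ?posrE ?invr_gt0.
Qed.

Definition point_class Xi k (i : 'I_k.+1) (c : borel_pclass R Xi k) :
    borel_pclass R Xi 0 := pclass_of (reroot (ppoint (prepr c) i)).

Lemma point_classE Xi k (i : 'I_k.+1) (X : pspace R Xi k) :
  point_class i (pclass_of X) = pclass_of (reroot (ppoint X i)).
Proof.
apply/pclass_ofP; have [f [fi fp fm]] := prepr_pclass_of X.
by rewrite -fp; exact: reroot_isometric.
Qed.

Lemma measurable_open_pclass Xi k (U : set (borel_pclass R Xi k)) :
  @lgh_open R Xi k U -> measurable U.
Proof. by move=> oU; apply: sub_sigma_algebra. Qed.

Lemma measurable_point_class Xi k (i : 'I_k.+1) :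
  measurable_fun setT (@point_class Xi k i).
Proof.
apply: (@measurability _ _ (borel_pclass R Xi k) (borel_pclass R Xi 0) setT _
  (@open (pclass R Xi 0))) => //.
move=> _ [U oU <-]; rewrite setTI; apply: measurable_open_pclass => X /=.
rewrite /preimage/= point_classE => /oU[e0 e00 eU].
have [e ep eP] := close_radius e00 (mdist_ge0 (ppoint X ord0) (ppoint X i)).
exists e => // Y [C CXY]; rewrite point_classE; apply: eU.
have [|e1 ee0 de] := eP e; first by rewrite ep lexx.
by apply: (reroot_close _ _ _ _ CXY) => //; case: CXY => + _ _ _ _; apply.
Qed.

Definition root_dist Xi (c : borel_pclass R Xi 1) : R :=
  mdist (ppoint (prepr c) ord0) (ppoint (prepr c) ord_max).

Lemma root_distE Xi (X : pspace R Xi 1) :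
  root_dist (pclass_of X) = mdist (ppoint X ord0) (ppoint X ord_max).
Proof.
have [f [[_ fi] fp fm]] := prepr_pclass_of X.
by rewrite -!fp fi.
Qed.

Lemma measurable_root_dist Xi (r : R) :
  measurable [set c : borel_pclass R Xi 1 | root_dist c < r].
Proof.
apply: measurable_open_pclass => X /=; rewrite root_distE => Xr.
exists (r - mdist (ppoint X ord0) (ppoint X ord_max)); first by rewrite subr_gt0.
move=> Y [C [Cp _ _ Cd _]]; rewrite root_distE.
have := Cd _ _ _ _ (Cp ord0) (Cp ord_max).
by rewrite ltr_distlC => /andP[_]; rewrite addrC subrK.
Qed.

End rerooting.

Section ball_sums.
Context (R : realType).
Implicit Types Xi : pseudoPMetricType R.

Definition oball (D : discreteSpace R) (r : R) (v : D) : set D :=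
  [set u | mdist v u < r].

Lemma finite_oball (D : discreteSpace R) (r : R) (v : D) :
  finite_set (oball r v).
Proof.
by apply: sub_finite_set (finite_closed_ball v r) => u; exact: ltW.
Qed.

Definition ball_sum Xi (f : borel_pclass R Xi 0 -> \bar R) (r : R)
    (X : pspace R Xi 0) : \bar R :=
  \esum_(v in oball r (ppoint X ord0)) f (pclass_of (reroot v)).

Lemma ball_sum_ge0 Xi (f : borel_pclass R Xi 0 -> \bar R) r X :
  (forall c, (0 <= f c)%E) -> (0 <= ball_sum f r X)%E.
Proof. by move=> f0; apply: esum_ge0. Qed.

Lemma ball_sum_isometric Xi (f : borel_pclass R Xi 0 -> \bar R) r X Y :
  pisometric X Y -> ball_sum f r X = ball_sum f r Y.
Proof.
case=> g [gi gp gm]; rewrite /ball_sum.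
rewrite (@reindex_esum _ _ _ (oball r (ppoint X ord0)) _ g).
  apply: eq_esum => x _; congr f; apply/(pclass_ofP (reroot x)).
  exact: reroot_isometric.
case: gi => [[h gK hK] gd]; split.
- by move=> x /=; rewrite /oball/= -gp gd.
- by move=> x y _ _; exact: (can_inj gK).
- move=> y yr; exists (h y) => //=.
  by move: yr; rewrite /oball/= -gp -{1}(hK y) gd.
Qed.

Definition ball_count Xi (r : R) (X : pspace R Xi 0) :
    {measure set (borel_pclass R Xi 0) -> \bar R} :=
  msum (fun i => dirac (pclass_of (reroot (nth (ppoint X ord0)
      (finmap.enum_fset (fset_set (oball r (ppoint X ord0)))) i)) :
      borel_pclass R Xi 0))
    (size (finmap.enum_fset (fset_set (oball r (ppoint X ord0))))).

Lemma ball_sumE Xi (f : borel_pclass R Xi 0 -> \bar R) r X :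
  (forall c, (0 <= f c)%E) -> measurable_fun setT f ->
  ball_sum f r X = (\int[ball_count r X]_c f c)%E.
Proof.
move=> f0 mf; rewrite ge0_integral_measure_sum//.
rewrite /ball_sum (esum_enum (ppoint X ord0))//; last exact: finite_oball.
by apply: eq_bigr => i _; rewrite integral_dirac// diracT mul1e.
Qed.

Lemma ball_countE Xi (U : set (borel_pclass R Xi 0)) r X :
  ball_count r X U = \esum_(v in oball r (ppoint X ord0) `&`
    [set v | U (pclass_of (reroot v))]) 1%E.
Proof.
rewrite esum_mkcondr (esum_enum (ppoint X ord0)); first last.
- by move=> x _; case: ifPn.
- exact: finite_oball.
rewrite /ball_count/= /msum; apply: eq_bigr => i _.
set v := nth _ _ _.
rewrite [LHS](diracE R (pclass_of (reroot v) : borel_pclass R Xi 0) U).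
have -> : (v \in [set v | U (pclass_of (reroot v))]) =
    (pclass_of (reroot v) \in U) by apply/idP/idP; rewrite !inE.
by case: ifPn => /=.
Qed.

Lemma ball_count_lsc Xi (U : set (pclass R Xi 0)) r (X : pspace R Xi 0) :
  lgh_open U -> exists2 e : R, 0 < e & forall Y, lgh_close e X Y ->
    (ball_count r X U <= ball_count r Y U)%E.
Proof.
move=> oU; set o := ppoint X ord0.
pose F := oball r o `&` [set v | U (pclass_of (reroot v))].
have fF : finite_set F by apply: sub_finite_set (finite_oball r o) => x [].
pose P (x : X) (e : R) := [/\ e <= 1, e <= r - mdist o x,
  (forall y : X, F y -> y != x -> e <= mdist x y) & mdist o x <= e^-1 /\
  forall Y C y, @lgh_correspondence R Xi 0 e X Y C -> C x y ->
    U (pclass_of (reroot y))].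
have [|e ep eP] := @common_radius R X F P fF.
  move=> x [xr Ux].
  have [e0 e00 e0U] := oU _ Ux.
  have [e1 e10 e1P] := close_radius e00 (mdist_ge0 o x).
  have [|e2 e20 e2P] := @common_radius R X (F `\` [set x])
    (fun y e => e <= mdist x y) (finite_setD _ fF).
    move=> y [Fy /eqP yx]; exists (mdist x y); last by move=> ? /andP[].
    by rewrite mdist_gt0 eq_sym.
  exists (Num.min (r - mdist o x) (Num.min e1 e2)).
    by rewrite !lt_min e10 e20 subr_gt0 !andbT.
  move=> e' /andP[e'0]; rewrite !le_min => /and3P[e'r e'1 e'2].
  have [//|a1 a2 a3] := e1P e' _; first by rewrite e'0.
  split=> //.
    by move=> y Fy /eqP yx; apply: (e2P e' y); [rewrite e'0|split].
  split; first by apply: le_trans a3; rewrite -addrA lerDl addr_ge0// invr_ge0 ltW.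
  by move=> Y C y CXY Cxy; apply: e0U; apply: (reroot_close _ _ _ _ CXY).
exists e => // Y [C CXY]; have {eP}FP x (Fx : F x) : P x e.
  by apply: eP => //; rewrite ep lexx.
have /choice[g gC] x : exists y, F x -> C x y.
  have [Fx|nFx] := pselect (F x); last by exists (ppoint Y ord0).
  have [_ _ _ [xe _]] := FP _ Fx.
  by case: CXY => _ /(_ _ xe)[y Cxy] _ _ _; exists y.
rewrite !ball_countE -/F -(@esum_image _ _ _ F g (fun=> 1%E)); last first.
  move=> x y; rewrite !inE => Fx Fy gxy; apply: contrapT => /eqP.
  rewrite eq_sym => yx; have [_ _ /(_ _ Fy yx) exy _] := FP _ Fx.
  case: CXY => _ _ _ Cd _; have := Cd _ _ _ _ (gC _ Fx) (gC _ Fy).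
  by rewrite gxy mdistxx subr0 ger0_norm ?mdist_ge0// ltNge exy.
apply: esum_subset => // _ [x Fx <-].
have [_ er _ [_ eU]] := FP _ Fx; split; last exact: eU CXY (gC _ Fx).
case: CXY => Cp _ _ Cd _; have := Cd _ _ _ _ (Cp ord0) (gC _ Fx).
rewrite ltr_distlC => /andP[_]; rewrite /oball/= -/o => /lt_le_trans; apply.
by rewrite -lerBrDl.
Qed.

Lemma ball_count_fin_num Xi (A : set (borel_pclass R Xi 0)) r X :
  ball_count r X A \is a fin_num.
Proof.
apply/sum_fin_numP => i _ _ /=.
set v := nth _ _ _.
by rewrite [X in X \is a _](diracE R (pclass_of (reroot v) : borel_pclass R Xi 0)).
Qed.

Lemma ball_count_isometric Xi (A : set (borel_pclass R Xi 0)) r X Y :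
  pisometric X Y -> ball_count r X A = ball_count r Y A.
Proof.
move=> XY; have E Z : ball_count r Z A = ball_sum (fun c => (\1_A c)%:E) r Z.
  rewrite ball_countE esum_mkcondr; apply: eq_esum => v _.
  rewrite indicE; have -> : (v \in [set v | A (pclass_of (reroot v))]) =
    (pclass_of (reroot v) \in A) by apply/idP/idP; rewrite !inE.
  by case: ifPn => /=.
by rewrite !E; exact: ball_sum_isometric.
Qed.

Lemma measurable_ball_count Xi (A : set (borel_pclass R Xi 0)) r :
  measurable A -> measurable_fun setT
    (fun c : borel_pclass R Xi 0 => ball_count r (prepr c) A).
Proof.
have mopen (U : set (borel_pclass R Xi 0)) : lgh_open U -> measurable_fun setT
    (fun c : borel_pclass R Xi 0 => ball_count r (prepr c) U).
  move=> oU; apply: (measurability _ (ErealGenOInfty.measurableE R)) => //.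
  move=> _ [_ [x ->] <-]; rewrite setTI; apply: measurable_open_pclass => X /=.
  have cE Z : ball_count r (prepr (pclass_of Z)) U = ball_count r Z U.
    by apply: ball_count_isometric; exact: prepr_pclass_of.
  rewrite /preimage/= cE in_itv/= andbT => xX.
  have [e e0 eP] := ball_count_lsc r X oU.
  exists e => // Y /eP; rewrite cE in_itv/= andbT; exact: lt_le_trans.
move: A; apply: (@dynkin_induction _ (borel_pclass R Xi 0)
  (@open (pclass R Xi 0)) (fun A => measurable_fun setT
    (fun c : borel_pclass R Xi 0 => ball_count r (prepr c) A))) => //.
- exact: openI.
- by apply: mopen => X _; exists 1.
- move=> S mS HS; apply: (eq_measurable_fun (fun c : borel_pclass R Xi 0 =>
      ball_count r (prepr c) setT - ball_count r (prepr c) S)%E).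
    move=> c _; have mC := measurableC mS.
    rewrite -(setUv S) measureU ?setICr// [X in (X - _)%E]addeC addeK//.
    exact: ball_count_fin_num.
  by apply: emeasurable_funB => //; apply: mopen => X _; exists 1.
- move=> F mF tF HF; apply: (eq_measurable_fun (fun c : borel_pclass R Xi 0 =>
      \sum_(0 <= k <oo) ball_count r (prepr c) (F k))%E).
    by move=> c _; rewrite measure_semi_bigcup//; exact: bigcup_measurable.
  exact: ge0_emeasurable_sum.
Qed.

Lemma measurable_ball_sum Xi (f : borel_pclass R Xi 0 -> \bar R) r :
  (forall c, (0 <= f c)%E) -> measurable_fun setT f ->
  measurable_fun setT (fun c : borel_pclass R Xi 0 => ball_sum f r (prepr c)).
Proof.
move=> f0 mf; apply: (eq_measurable_fun (fun c : borel_pclass R Xi 0 =>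
    \int[ball_count r (prepr c)]_y f y)%E).
  by move=> c _; rewrite ball_sumE.
apply: measurable_fun_integral_kernel => // U mU.
exact: measurable_ball_count.
Qed.

End ball_sums.

Section real_marks.
Context (R : realType).

Lemma measurable_inv : measurable_fun setT (@GRing.inv R).
Proof.
apply: (eq_measurable_fun (fun x : R => x * (x ^+ 2) `^ (-1))).
  move=> x _; rewrite powR_inv1 ?sqr_ge0//.
  have [->|x0] := eqVneq x 0; first by rewrite mul0r invr0.
  by rewrite expr2 invfM mulrA divff// mul1r.
apply: measurable_funM => //.
exact: (@measurableT_comp _ _ _ _ _ _ (@powR R ^~ (-1))).
Qed.

Definition root_mark (c : Dmarked R R) : R := pmark (ppoint (prepr c) ord0).

Lemma root_markE (X : pspace R R 0) :
  root_mark (pclass_of X) = pmark (ppoint X ord0).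
Proof.
by have [f [_ fp fm]] := prepr_pclass_of X; rewrite /root_mark -fm fp.
Qed.

Lemma measurable_root_mark : measurable_fun setT root_mark.
Proof.
apply: (measurability _ (RGenOInfty.measurableE R)) => //.
move=> _ [_ [x ->] <-]; rewrite setTI; apply: measurable_open_pclass => X /=.
rewrite /preimage/= root_markE in_itv/= andbT => xX.
exists (pmark (ppoint X ord0) - x); first by rewrite subr_gt0.
move=> Y [C [Cp _ _ _ Cm]]; rewrite root_markE in_itv/= andbT.
have := Cm _ _ (Cp ord0); rewrite /ball/= ltr_distlC => /andP[+ _].
by rewrite opprB addrC subrK.
Qed.

(* On nonnegative marks this is the mark of the root; marks are truncated at 0
   because they are only real. *)
Definition root_weight (c : Dmarked R R) : \bar R := (Num.max (root_mark c) 0)%:E.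

Lemma root_weight_ge0 c : (0 <= root_weight c)%E.
Proof. by rewrite lee_fin le_max lexx orbT. Qed.

Lemma measurable_root_weight : measurable_fun setT root_weight.
Proof.
apply/measurable_EFinP; apply: measurable_maxr => //.
exact: measurable_root_mark.
Qed.

Definition weight_fraction (r : R) (c : Dmarked R R) : \bar R :=
  (fine (root_weight c) / fine (ball_sum root_weight r (prepr c)))%:E.

Lemma weight_fraction_ge0 r c : (0 <= weight_fraction r c)%E.
Proof.
rewrite lee_fin divr_ge0// fine_ge0 ?root_weight_ge0//.
by apply: ball_sum_ge0; exact: root_weight_ge0.
Qed.

Lemma measurable_weight_fraction r : measurable_fun setT (weight_fraction r).
Proof.
apply/measurable_EFinP; apply: measurable_funM.
  apply: measurableT_comp; first exact: fine_measurable.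
  exact: measurable_root_weight.
apply: measurableT_comp; first exact: measurable_inv.
apply: measurableT_comp; first exact: fine_measurable.
by apply: measurable_ball_sum;
  [exact: root_weight_ge0 | exact: measurable_root_weight].
Qed.

Lemma root_weight_marked (D : discreteSpace R) (o : D) (m : D -> R) :
  (forall v, 0 <= m v) -> root_weight (marked o m) = (m o)%:E.
Proof. by move=> m0; rewrite /root_weight root_markE max_l. Qed.

Lemma weight_fraction_marked (r : R) (D : discreteSpace R) (o : D) (m : D -> R) :
  (forall v, 0 <= m v) -> weight_fraction r (marked o m) =
  (m o / fine (\esum_(v in oball r o) (m v)%:E))%:E.
Proof.
move=> m0; rewrite /weight_fraction root_weight_marked//.
rewrite (ball_sum_isometric _ _ (prepr_pclass_of _)) /ball_sum.
congr (_ / fine _)%:E; apply: eq_esum => v _.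
exact: (root_weight_marked (D := D)).
Qed.

End real_marks.

(** * Means of equivariant processes *)

Section process_means.
Context (R : realType) (Xi : pseudoPMetricType R).

Definition markings (D : discreteSpace R) :=
  g_sigma_algebraType [set C : set (D -> Xi) |
    exists (v : D) (U : set Xi), open U /\ C = [set m | U (m v)]].

Lemma measurable_marking_comp (D1 D2 : discreteSpace R) (rho : D1 -> D2) :
  measurable_fun setT (fun m : markings D2 => m \o rho : markings D1).
Proof.
apply: (@measurability _ _ (markings D2) (markings D1) setT _
  [set C : set (D1 -> Xi) |
    exists (v : D1) (U : set Xi), open U /\ C = [set m | U (m v)]]) => //.
move=> _ [_ [v [U [oU ->]]] <-]; rewrite setTI.
by apply: sub_sigma_algebra; exists (rho v), U.
Qed.

Lemma marked_isometry (D1 D2 : discreteSpace R) (rho : D1 -> D2) (x : D1)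
    (m : D2 -> Xi) : is_isometry rho ->
  marked (rho x) m = marked x (m \o rho).
Proof.
move=> hrho; apply/esym.
apply/(pclass_ofP (PSpace (fun=> x : D1) (m \o rho))).
by exists rho.
Qed.

Context (d : discreteSpace R -> measure_display)
  (Omega : forall D, measurableType (d D))
  (P : forall D, probability (Omega D) R)
  (Z : forall D : discreteSpace R, Omega D -> D -> Xi).

Definition process_mean (Phi : Dmarked R Xi -> \bar R) (D : discreteSpace R)
    (o : D) : \bar R :=
  (\int[P D]_omega Phi (marked o (Z (D := D) omega)))%E.

Lemma process_mean_ge0 (Phi : Dmarked R Xi -> \bar R) (D : discreteSpace R)
    (o : D) : (forall c, (0 <= Phi c)%E) -> (0 <= process_mean Phi o)%E.
Proof. by move=> Phi0; apply: integral_ge0. Qed.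

Hypothesis hZ : equivariant_process P Z.

Lemma measurable_process (D : discreteSpace R) :
  measurable_fun setT (@Z D : Omega D -> markings D).
Proof. by move=> _ S mS; rewrite setTI; case: hZ => + _ _; apply. Qed.

Context (Phi : Dmarked R Xi -> \bar R).
Hypotheses (Phi0 : forall c, (0 <= Phi c)%E) (mPhi : measurable_fun setT Phi).
Hypothesis mPhim : forall (D : discreteSpace R) (o : D),
  measurable_fun setT (fun m : markings D => Phi (marked o m)).

Lemma process_mean_isometric (D1 D2 : discreteSpace R) (rho : D1 -> D2) x :
  is_isometry rho -> process_mean Phi (rho x) = process_mean Phi x.
Proof.
move=> hrho; rewrite /process_mean.
pose h (m : markings D1) := Phi (marked x m).
pose phi2 (omega : Omega D2) : markings D1 := Z omega \o rho.
have mphi2 : measurable_fun setT phi2.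
  apply: (@measurableT_comp _ _ _ _ _ _
    (fun m : markings D2 => m \o rho : markings D1)).
    exact: measurable_marking_comp.
  exact: measurable_process.
have mh : measurable_fun setT h by exact: mPhim.
rewrite (eq_integral (h \o phi2)); last first.
  by move=> omega _; rewrite marked_isometry.
change (\int[P D2]_x (h \o phi2) x =
  \int[P D1]_x (h \o (@Z D1 : _ -> markings D1)) x)%E.
rewrite -(@ge0_integral_pushforward _ _ _ _ _ phi2 mphi2 _ setT h)//;
  last by move=> m _; exact: Phi0.
rewrite -(@ge0_integral_pushforward _ _ _ _ _ _ (@measurable_process D1) _ setT h)//;
  last by move=> m _; exact: Phi0.
pose X1 : {mfun Omega D1 >-> markings D1} :=
  HB.pack (@Z D1 : Omega D1 -> markings D1)
    (isMeasurableFun.Build _ _ _ _ _ (@measurable_process D1)).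
pose X2 : {mfun Omega D2 >-> markings D1} :=
  HB.pack phi2 (isMeasurableFun.Build _ _ _ _ _ mphi2).
apply: (@eq_measure_integral _ _ _ setT (distribution (P D1) X1)
  (distribution (P D2) X2)) => S mS _.
by case: hZ => _ + _; apply.
Qed.

Lemma measurable_process_mean : measurable_fun setT
  (fun c : Dstar R => process_mean Phi (droot c)).
Proof.
have mX c : measurable_fun setT
    (fun omega : Omega (dspace c) => Phi (marked (droot c) (Z omega))).
  apply: (@measurableT_comp _ _ _ _ _ _
    (fun m : markings (dspace c) => Phi (marked (droot c) m))) => //.
  exact: measurable_process.
pose X c : {mfun Omega (dspace c) >-> \bar R} :=
  HB.pack (fun omega : Omega (dspace c) => Phi (marked (droot c) (Z omega)))
    (isMeasurableFun.Build _ _ _ _ _ (mX c)).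
apply: (eq_measurable_fun
  (fun c : Dstar R => \int[distribution (P (dspace c)) (X c)]_y `|y|)%E).
  move=> c _; rewrite ge0_integral_pushforward//=.
  by apply: eq_integral => omega _ /=; rewrite gee0_abs.
apply: measurable_fun_integral_kernel => // U mU.
case: hZ => _ _ /(_ (Phi @^-1` U)); apply.
by rewrite -[X in measurable X]setTI; exact: mPhi.
Qed.

End process_means.

Section unmarked_points.
Context (R : realType).

Definition pointed (D : discreteSpace R) (x : D) : Dstar R :=
  @marked R (no_mark R) D x (fun=> tt).

Lemma pointed_reroot k (X : pspace R (no_mark R) k) (x : X) :
  pclass_of (reroot x) = pointed x.
Proof.
apply/(pclass_ofP (reroot x)); exists id; split=> //; first by split=> //; exists id.
by move=> y /=; case: (pmark y).
Qed.

Lemma pointed_droot (c : Dstar R) : pointed (droot c) = c.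
Proof.
by rewrite -[RHS]pclass_of_prepr -reroot_point pointed_reroot.
Qed.

Lemma pointed_invariant (T : Type) (F : forall D : discreteSpace R, D -> T) :
  (forall (D1 D2 : discreteSpace R) (rho : D1 -> D2) (x : D1), is_isometry rho ->
    F D2 (rho x) = F D1 x) ->
  forall (D : discreteSpace R) (x : D),
    F (dspace (pointed x)) (droot (pointed x)) = F D x.
Proof.
move=> FP D x.
have [f [fi fp _]] := prepr_pclass_of
  (@PSpace R (no_mark R) 0 D (fun=> x) (fun=> tt)).
by rewrite -[RHS](congr1 (F D) (fp ord0)) FP.
Qed.

Lemma ball_sum_unmarked (f : Dstar R -> \bar R) r (c : Dstar R) :
  ball_sum f r (prepr c) = \esum_(v in oball r (droot c)) f (pointed v).
Proof. by apply: eq_esum => v _; rewrite pointed_reroot. Qed.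

End unmarked_points.

Section weights.
Context (R : realType) (D : discreteSpace R) (m : D -> R).
Hypothesis m0 : forall v, 0 <= m v.

Definition wsum (r : R) (o : D) : R := fine (\esum_(v in oball r o) (m v)%:E).

Lemma wsumE r o : (wsum r o)%:E = \esum_(v in oball r o) (m v)%:E.
Proof.
rewrite /wsum (esum_enum o).
- by rewrite fineK//; apply/sum_fin_numP.
- exact: finite_oball.
- by move=> v _; rewrite lee_fin.
Qed.

Lemma wsum_ge0 r o : 0 <= wsum r o.
Proof. by rewrite -lee_fin wsumE; apply: esum_ge0 => v _; rewrite lee_fin. Qed.

Lemma wsum_ge r o v : mdist o v < r -> m v <= wsum r o.
Proof.
move=> vr; rewrite -lee_fin wsumE.
rewrite -(@esum_set1 _ _ v (fun v => (m v)%:E)) ?lee_fin//.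
by apply: esum_subset => // [_ ->//|x _]; rewrite lee_fin.
Qed.

Lemma fraction_le1 r v : m v / wsum r v <= 1.
Proof.
have [r0|r0] := ltP 0 r; last first.
  suff -> : wsum r v = 0 by rewrite invr0 mulr0.
  rewrite /wsum (_ : oball r v = set0) ?esum_set0// -subset0 => u.
  by rewrite /oball/= ltNge (le_trans r0)// mdist_ge0.
have le := wsum_ge (o := v) (v := v); rewrite mdistxx in le.
have [->|S0] := eqVneq (wsum r v) 0; first by rewrite invr0 mulr0.
by rewrite ler_pdivrMr ?mul1r ?le// lt0r S0 wsum_ge0.
Qed.

Lemma wsum_fraction_le1 r o :
  (\esum_(v in oball r o) (m v / wsum (r + r) v)%:E <= 1)%E.
Proof.
have le v : oball r o v -> m v / wsum (r + r) v <= (wsum r o)^-1 * m v.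
  rewrite /oball/= => vr; have := wsum_ge0 r o; rewrite le_eqVlt => /orP[/eqP S0|S0].
    have /eqP -> : m v == 0 by rewrite eq_le m0 andbT S0 wsum_ge.
    by rewrite mul0r mulr0.
  have S0S : wsum r o <= wsum (r + r) v.
    rewrite -lee_fin !wsumE; apply: esum_subset => [u|x _]; last by rewrite lee_fin.
    rewrite /oball/= => ur; apply: le_lt_trans (metric_triangle _ o _) _.
    by rewrite metric_sym ltrD.
  rewrite mulrC ler_wpM2r// lef_pV2// posrE//; exact: lt_le_trans S0S.
apply: (@le_trans _ _ (\esum_(v in oball r o) ((wsum r o)^-1 * m v)%:E)).
  by apply: le_esum => v vr; rewrite lee_fin; exact: le.
rewrite (esum_enum o)//; last 2 first.
- exact: finite_oball.
- by move=> v _; rewrite lee_fin mulr_ge0// invr_ge0 wsum_ge0.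
under eq_bigr do rewrite EFinM.
rewrite -ge0_sume_distrr; last by move=> i _; rewrite lee_fin.
rewrite -(@esum_enum _ _ o (oball r o) (fun v => (m v)%:E))//; last 2 first.
- exact: finite_oball.
- by move=> v _; rewrite lee_fin.
rewrite -wsumE -EFinM lee_fin.
have [->|S0] := eqVneq (wsum r o) 0; first by rewrite mulr0.
by rewrite mulVf.
Qed.

End weights.

(** * Mass transport *)

Section mass_transport.
Context (R : realType) (mu : probability (Dstar R) R).
Hypothesis hmu : unimodular mu.
Local Open Scope ereal_scope.

Lemma mass_transport (A B : Dstar R -> \bar R) (r : R) :
  (forall c, 0 <= A c) -> (forall c, 0 <= B c) ->
  measurable_fun setT A -> measurable_fun setT B ->
  \int[mu]_c (A c * ball_sum B r (prepr c)) =
  \int[mu]_c (B c * ball_sum A r (prepr c)).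
Proof.
move=> A0 B0 mA mB.
pose g (b : Dstar2 R) := A (point_class ord0 b) * B (point_class ord_max b) *
  (\1_[set b : Dstar2 R | (root_dist b < r)%R] b)%:E.
have mg : measurable_fun setT g.
  apply: emeasurable_funM.
    by apply: emeasurable_funM; apply: measurableT_comp => //;
      exact: measurable_point_class.
  by apply/measurable_EFinP/measurable_indic; exact: measurable_root_dist.
have g0 b : 0 <= g b by rewrite !mule_ge0// lee_fin.
have gE (D : discreteSpace R) (o v : D) : g (birooted o v) =
    if (mdist o v < r)%R then A (pointed o) * B (pointed v) else 0.
  rewrite /g /birooted !point_classE !pointed_reroot/= indicE.
  rewrite [X in (nat_of_bool X)%:R%:E](_ : _ = (mdist o v < r)%R).
    by case: ifP => _; rewrite ?mule1 ?mule0.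
  by apply/idP/idP; rewrite inE/= root_distE.
have scale (f : Dstar R -> \bar R) (c : Dstar R) k :
      0 <= k -> (forall c, 0 <= f c) ->
    \esum_(v in [set: dspace c])
      (if (mdist (droot c) v < r)%R then k * f (pointed v) else 0) =
    k * ball_sum f r (prepr c).
  move=> k0 f0; rewrite ball_sum_unmarked.
  rewrite [in RHS](esum_enum (droot c)); [|exact: finite_oball|by []].
  rewrite ge0_sume_distrr//.
  rewrite -(@esum_enum _ _ (droot c) _ (fun v => k * f (pointed v))); first last.
  - by move=> v _; rewrite mule_ge0.
  - exact: finite_oball.
  rewrite [RHS]esum_mkcond; apply: eq_esum => v _.
  by rewrite [v \in _](_ : _ = (mdist (droot c) v < r)%R)//;
    apply/idP/idP; rewrite inE.
transitivity (\int[mu]_c \esum_(v in [set: dspace c]) g (birooted (droot c) v)).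
  apply: eq_integral => c _; rewrite -scale//; apply: eq_esum => v _.
  by rewrite gE pointed_droot.
rewrite (hmu mg g0); apply: eq_integral => c _; rewrite -scale//.
apply: eq_esum => v _.
by rewrite gE pointed_droot metric_sym muleC.
Qed.

Lemma ae_all_points (f : Dstar R -> \bar R) : (forall c, 0 <= f c) ->
  measurable_fun setT f -> {ae mu, forall c, f c < +oo} ->
  {ae mu, forall c, forall v : dspace c, f (pointed v) < +oo}.
Proof.
move=> f0 mf foo; pose I := f @^-1` [set +oo].
have mI : measurable I by rewrite -[I]setTI; exact: mf.
pose B (c : Dstar R) : \bar R := (\1_I c)%:E.
have B0 c : 0 <= B c by rewrite lee_fin.
have mB : measurable_fun setT B by exact/measurable_EFinP/measurable_indic.
have m1 : measurable_fun setT (cst 1 : Dstar R -> \bar R) by [].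
have sum0 n : {ae mu, forall c, ball_sum B n%:R (prepr c) = 0}.
  have ms := measurable_ball_sum n%:R B0 mB.
  have := mass_transport n%:R (fun=> lee01) B0 m1 mB.
  under eq_integral do rewrite mul1e.
  move=> E; have : \int[mu]_c `|ball_sum B n%:R (prepr c)| = 0.
    under eq_integral do rewrite gee0_abs ?ball_sum_ge0//.
    rewrite E; rewrite (@ae_eq_integral _ _ _ mu setT (cst 0))//.
    - exact: integral0.
    - by apply: emeasurable_funM => //; apply: measurable_ball_sum.
    - apply: filterS foo => c fc _; rewrite /B indicE memNset ?mul0e// /I/= => fy.
      by rewrite fy in fc.
  by move/ae_eq_integral_abs => /(_ measurableT ms); apply: filterS => c; apply.
have := ae_foralln sum0; apply: filterS => c H v.
rewrite ltNge leye_eq; apply/negP => /eqP fv.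
have := H (Num.truncn (mdist (droot c) v)).+1; apply/eqP.
rewrite gt_eqF// ball_sum_unmarked.
apply: (@lt_le_trans _ _ (\esum_(u in [set v]) B (pointed u))).
  by rewrite esum_set1// /B indicE mem_set// lte_fin ltr01.
by apply: esum_subset => // _ ->; rewrite /oball/= truncnS_gt.
Qed.

End mass_transport.

Section limit_inferior.
Context (R : realType).
Local Open Scope ereal_scope.

Lemma limn_einf_lt_frequently (u : (\bar R)^nat) (M : \bar R) :
  limn_einf u < M -> forall N, exists2 n, (N <= n)%N & u n < M.
Proof.
rewrite /limn_einf /limn_esup -/(limf_einf u \oo) limf_einfE => uM N.
have /ereal_inf_lt[_ [n /= Nn <-] unM] :
    ereal_inf (u @` [set n | (N <= n)%N]) < M.
  apply: le_lt_trans uM; apply: ereal_sup_ubound.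
  by exists [set n | (N <= n)%N] => //; exact: nbhs_infty_ge.
by exists n.
Qed.

Lemma limn_einf_le_frequently (u : (\bar R)^nat) (M : \bar R) :
  (forall N, exists2 n, (N <= n)%N & u n <= M) -> limn_einf u <= M.
Proof.
move=> uM; rewrite /limn_einf /limn_esup -/(limf_einf u \oo) limf_einfE.
apply: ge_ereal_sup => _ [V [N _ NV] <-].
have [n Nn unM] := uM N; apply: le_trans unM; apply: ereal_inf_lbound.
by exists n => //; exact: NV.
Qed.

Lemma limn_einf_ge0 (u : (\bar R)^nat) : (forall n, 0 <= u n) ->
  0 <= limn_einf u.
Proof.
move=> u0; rewrite /limn_einf /limn_esup -/(limf_einf u \oo) limf_einfE.
apply: (@le_trans _ _ (ereal_inf (range u))).
  by apply: le_ereal_inf_tmp => _ [n _ <-].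
by apply: ereal_sup_ubound; exists setT => //; exact: filterT.
Qed.

Lemma ae_lty d (T : measurableType d) (m : {measure set T -> \bar R})
    (f : T -> \bar R) : (forall x, 0 <= f x) -> measurable_fun setT f ->
  \int[m]_x f x < +oo -> {ae m, forall x, f x < +oo}.
Proof.
move=> f0 mf foo; have /integrable_ae : m.-integrable setT f.
  by apply/integrableP; split=> //; under eq_integral do rewrite gee0_abs//.
move/(_ measurableT); apply: filterS => x /(_ Logic.I).
by rewrite ge0_fin_numE.
Qed.

End limit_inferior.

Section mean_weights.
Context (R : realType).

Lemma measurable_eval (D : discreteSpace R) (v : D) :
  measurable_fun setT (fun m : markings R D => m v : R).
Proof.
apply: (measurability _ (RGenOpens.measurableE R)) => //.
move=> _ [_ [a [b ->]] <-]; rewrite setTI.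
apply: sub_sigma_algebra; exists v, `]a, b[%classic.
by split => //; exact: interval_open.
Qed.

Lemma measurable_root_weight_marked (D : discreteSpace R) (o : D) :
  measurable_fun setT (fun m : markings R D => root_weight (marked o m)).
Proof.
apply: (eq_measurable_fun (fun m : markings R D => (Num.max (m o) 0)%:E)).
  by move=> m _; rewrite /root_weight root_markE.
by apply/measurable_EFinP; apply: measurable_maxr => //; exact: measurable_eval.
Qed.

Lemma measurable_weight_fraction_marked r (D : discreteSpace R) (o : D) :
  measurable_fun setT (fun m : markings R D => weight_fraction r (marked o m)).
Proof.
apply: (eq_measurable_fun (fun m : markings R D => (fine (root_weight (marked o m)) *
    (fine (\sum_(i < size (finmap.enum_fset (fset_set (oball r o))))
      root_weight
        (marked (nth o (finmap.enum_fset (fset_set (oball r o))) i) m)))^-1)%:E)).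
  move=> m _; rewrite /weight_fraction.
  rewrite (ball_sum_isometric _ _ (prepr_pclass_of _)) /ball_sum (esum_enum o)//.
    exact: finite_oball.
  by move=> v _; exact: root_weight_ge0.
apply/measurable_EFinP; apply: measurable_funM.
  apply: measurableT_comp; first exact: fine_measurable.
  exact: measurable_root_weight_marked.
apply: measurableT_comp; first exact: measurable_inv.
apply: measurableT_comp; first exact: fine_measurable.
by apply: emeasurable_sum => i; exact: measurable_root_weight_marked.
Qed.

Context (d : discreteSpace R -> measure_display)
  (Omega : forall D, measurableType (d D))
  (P : forall D, probability (Omega D) R)
  (w : forall D : discreteSpace R, Omega D -> D -> R).
Hypothesis hw : equivariant_weight P w.
Local Open Scope ereal_scope.

Let w0 D omega v : (0 <= w (D := D) omega v)%R. Proof. by case: hw. Qed.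
Let pw : equivariant_process P w. Proof. by case: hw. Qed.

Definition mean_weight (c : Dstar R) : \bar R :=
  process_mean P w (@root_weight R) (droot c).

(* The radius is r + r so that the ball contains the r-ball around any point at
   distance less than r. *)
Definition mean_fraction (r : R) (c : Dstar R) : \bar R :=
  process_mean P w (weight_fraction (r + r)) (droot c).

Lemma mean_weight_ge0 c : 0 <= mean_weight c.
Proof. by apply: process_mean_ge0; exact: root_weight_ge0. Qed.

Lemma mean_fraction_ge0 r c : 0 <= mean_fraction r c.
Proof. by apply: process_mean_ge0; exact: weight_fraction_ge0. Qed.

Lemma measurable_mean_weight : measurable_fun setT mean_weight.
Proof.
apply: (measurable_process_mean pw).
- exact: root_weight_ge0.
- exact: measurable_root_weight.
- exact: measurable_root_weight_marked.
Qed.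

Lemma measurable_mean_fraction r : measurable_fun setT (mean_fraction r).
Proof.
apply: (measurable_process_mean pw).
- exact: weight_fraction_ge0.
- exact: measurable_weight_fraction.
- exact: measurable_weight_fraction_marked.
Qed.

Lemma mean_weight_pointed (D : discreteSpace R) (v : D) :
  mean_weight (pointed v) = \int[P D]_omega (w omega v)%:E.
Proof.
rewrite /mean_weight (pointed_invariant (F := process_mean P w (@root_weight R))).
  by apply: eq_integral => omega _; rewrite root_weight_marked.
move=> D1 D2 rho x hrho; apply: (process_mean_isometric pw) => //.
- exact: root_weight_ge0.
- exact: measurable_root_weight_marked.
Qed.

Lemma mean_fraction_pointed r (D : discreteSpace R) (v : D) :
  mean_fraction r (pointed v) =
  \int[P D]_omega (w omega v / wsum (w omega) (r + r) v)%:E.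
Proof.
rewrite /mean_fraction.
rewrite (pointed_invariant (F := process_mean P w (weight_fraction (r + r)))).
  by apply: eq_integral => omega _; rewrite weight_fraction_marked.
move=> D1 D2 rho x hrho; apply: (process_mean_isometric pw) => //.
- exact: weight_fraction_ge0.
- exact: measurable_weight_fraction_marked.
Qed.

Lemma measurable_weight (D : discreteSpace R) (v : D) :
  measurable_fun setT (fun omega : Omega D => w omega v).
Proof.
exact: (measurableT_comp (measurable_eval v) (@measurable_process _ _ _ _ _ _ pw D)).
Qed.

Lemma measurable_wsum (D : discreteSpace R) r (v : D) :
  measurable_fun setT (fun omega : Omega D => wsum (w omega) r v).
Proof.
apply/measurable_EFinP; apply: (eq_measurable_fun (fun omega : Omega D =>
    (\sum_(i < size (finmap.enum_fset (fset_set (oball r v))))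
      (w omega (nth v (finmap.enum_fset (fset_set (oball r v))) i))%:E))).
  move=> omega _ /=; rewrite wsumE// (esum_enum v)//.
    exact: finite_oball.
  by move=> u _; rewrite lee_fin.
by apply: emeasurable_sum => i; apply/measurable_EFinP; exact: measurable_weight.
Qed.

Lemma measurable_fraction (D : discreteSpace R) r (v : D) : measurable_fun setT
  (fun omega : Omega D => (w omega v / wsum (w omega) r v)%:E).
Proof.
apply/measurable_EFinP; apply: measurable_funM; first exact: measurable_weight.
by apply: measurableT_comp; [exact: measurable_inv|exact: measurable_wsum].
Qed.

Lemma mean_fraction_le1 r c : mean_fraction r c <= 1.
Proof.
rewrite -(pointed_droot c) mean_fraction_pointed.
apply: (@le_trans _ _ (\int[P (dspace c)]_omega cst 1 omega)); last first.
  by rewrite integral_cst// mul1e; exact: probability_le1.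
apply: ge0_le_integral => //.
- by move=> omega _; rewrite lee_fin divr_ge0// wsum_ge0.
- exact: measurable_fraction.
- by move=> omega _; rewrite lee_fin fraction_le1.
Qed.

Lemma expected_root_weightE (mu : probability (Dstar R) R) :
  expected_root_weight P mu w = \int[mu]_c mean_weight c.
Proof.
by apply: eq_integral => c _; rewrite -mean_weight_pointed pointed_droot.
Qed.

Lemma integral_wsum (D : discreteSpace R) r (v : D) :
  \int[P D]_omega (wsum (w omega) r v)%:E =
  ball_sum mean_weight r (prepr (pointed v)).
Proof.
rewrite (ball_sum_isometric _ _ (prepr_pclass_of _)) /ball_sum.
rewrite (esum_enum v)//; last 2 first.
- exact: finite_oball.
- by move=> u _; exact: mean_weight_ge0.
under eq_bigr => i _ do rewrite pointed_reroot mean_weight_pointed.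
rewrite -ge0_integral_sum//.
- apply: eq_integral => omega _; rewrite wsumE// (esum_enum v)//.
    exact: finite_oball.
  by move=> u _; rewrite lee_fin.
- by move=> i; apply/measurable_EFinP; exact: measurable_weight.
- by move=> i x _; rewrite lee_fin.
Qed.

Lemma ball_sum_mean_fraction_le1 r c :
  ball_sum (mean_fraction r) r (prepr c) <= 1.
Proof.
rewrite ball_sum_unmarked (esum_enum (droot c)); last 2 first.
- exact: finite_oball.
- by move=> u _; exact: mean_fraction_ge0.
under eq_bigr => i _ do rewrite mean_fraction_pointed.
have fr0 omega (v : dspace c) : 0 <= (w omega v / wsum (w omega) (r + r) v)%:E.
  by rewrite lee_fin divr_ge0// wsum_ge0.
have mfr (v : dspace c) := measurable_fraction (r + r) v.
rewrite -ge0_integral_sum//.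
apply: (@le_trans _ _ (\int[P (dspace c)]_omega cst 1 omega)); last first.
  by rewrite integral_cst// mul1e; exact: probability_le1.
apply: ge0_le_integral => //.
- by move=> omega _; apply: sume_ge0.
- exact: emeasurable_sum.
- move=> omega _.
  apply: le_trans (wsum_fraction_le1 (w0 (D := dspace c) omega) r (droot c)).
  by rewrite (esum_enum (droot c))//; exact: finite_oball.
Qed.

End mean_weights.

(** * Growth rates *)

Section growth.
Context (R : realType).

Lemma ereal_between (x y : \bar R) : (x < y)%E ->
  exists r : R, (x < r%:E)%E /\ (r%:E < y)%E.
Proof.
case: x y => [a| |] [b| |]//=.
- rewrite lte_fin => ab; exists ((a + b) / 2); rewrite !lte_fin.
  by rewrite ltr_pdivlMr// ltr_pdivrMr// !mulr_natr !mulr2n ltrD2l ltrD2r.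
- by move=> _; exists (a + 1); rewrite lte_fin ltrDl ltr01 ltry.
- by move=> _; exists (b - 1); rewrite lte_fin ltrBlDr ltrDl ltr01 ltNyr.
- by move=> _; exists 0; rewrite ltNyr ltry.
Qed.

Lemma upper_growth_lt (f : R -> \bar R) (t : \bar R) : (upper_growth f < t)%E ->
  exists A : R, forall r, A < r -> (lne (f r) / (ln r)%:E < t)%E.
Proof.
rewrite /upper_growth limf_esupE => /ereal_inf_lt[_ [V [A [_ AV]] <-]] Vt.
exists A => r /AV Vr; apply: le_lt_trans Vt; apply: ereal_sup_ubound.
by exists r.
Qed.

Lemma lower_growth_gt (f : R -> \bar R) (t : \bar R) : (t < lower_growth f)%E ->
  exists A : R, forall r, A < r -> (t < lne (f r) / (ln r)%:E)%E.
Proof.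
rewrite /lower_growth limf_einfE => /ereal_sup_gt[_ [V [A [_ AV]] <-]] Vt.
exists A => r /AV Vr; apply: lt_le_trans Vt _; apply: ereal_inf_lbound.
by exists r.
Qed.

Lemma lne_div_ln (x r : R) : 1 < r ->
  (lne x%:E / (ln r)%:E = lne x%:E * ((ln r)^-1)%:E)%E.
Proof. by move=> r1; rewrite inver gt_eqF// ln_gt0. Qed.

(* The logarithms of the scales r and s differ by at most ln 4. *)
Lemma growth_le (f1 f2 : R -> R) (K c : R) : 0 < K -> 0 < c ->
  (forall A, exists r s,
    [/\ A < r, r <= s, s <= 4 * r, c <= f2 s & f1 r <= K * f2 s]) ->
  (lower_growth (fun r => (f1 r)%:E) <= upper_growth (fun r => (f2 r)%:E))%E.
Proof.
move=> K0 c0 H; rewrite leNgt; apply/negP.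
move=> /ereal_between[t [ft /ereal_between[t' [tt' ft']]]].
rewrite lte_fin in tt'.
have [A1 A1P] := upper_growth_lt ft; have [A2 A2P] := lower_growth_gt ft'.
pose B := (ln K + `|t| * ln 4) / (t' - t).
have [r [s [Ar rs sr cs rK]]] := H (Num.max (Num.max A1 A2) (Num.max 1 (expR B))).
move: Ar; rewrite !gt_max -!andbA => /and4P[A1r A2r r1 Br].
have r0 : 0 < r by exact: lt_trans r1.
have s1 : 1 < s by exact: lt_le_trans rs.
have s0 : 0 < s by exact: lt_trans s1.
have fs0 : 0 < f2 s by exact: lt_le_trans cs.
have lnr0 : 0 < ln r by rewrite ln_gt0.
have lns0 : 0 < ln s by rewrite ln_gt0.
have := A2P r A2r; rewrite lne_div_ln// lte_pdivlMr// => Hr.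
have fr0 : 0 < f1 r.
  rewrite ltNge; apply/negP => fr0; move: Hr.
  by rewrite le0_lneNy ?lee_fin// ltNge leNye.
move: Hr; rewrite lne_EFin// -EFinM lte_fin => Hr.
have := A1P s (lt_le_trans A1r rs).
rewrite lne_div_ln// lte_pdivrMr// lne_EFin// -EFinM lte_fin => Hs.
have lrs : ln r <= ln s by rewrite ler_ln ?posrE.
have lsr : ln s <= ln 4 + ln r.
  by rewrite -lnM ?posrE// ler_ln ?posrE// mulr_gt0.
have frs : ln (f1 r) <= ln K + ln (f2 s).
  by rewrite -lnM ?posrE// ler_ln ?posrE// mulr_gt0.
have Bln : B < ln r by rewrite -(expRK B) ltr_ln ?posrE// expR_gt0.
have : t * (ln s - ln r) <= `|t| * ln 4.
  apply: le_trans (ler_norm _) _; rewrite normrM ler_wpM2l//.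
  rewrite ger0_norm ?subr_ge0//; lra.
move: Bln; rewrite /B ltr_pdivrMr ?subr_gt0// => Bln; nra.
Qed.

End growth.

Section comparison.
Context (R : realType) (mu : probability (Dstar R) R).
Hypothesis hmu : unimodular mu.
Context (d : discreteSpace R -> measure_display)
  (Omega : forall D : discreteSpace R, measurableType (d D))
  (P : forall D : discreteSpace R, probability (Omega D) R)
  (w1 w2 : forall D : discreteSpace R, Omega D -> D -> R).
Hypotheses (hw1 : equivariant_weight P w1) (hw2 : equivariant_weight P w2).

Let w10 D omega v : 0 <= w1 (D := D) omega v. Proof. by case: hw1. Qed.
Let w20 D omega v : 0 <= w2 (D := D) omega v. Proof. by case: hw2. Qed.

Local Open Scope ereal_scope.

Let transported (n : nat) (c : Dstar R) : \bar R :=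
  mean_fraction P w2 n%:R c * ball_sum (mean_weight P w1) n%:R (prepr c).

Let transported_ge0 n c : 0 <= transported n c.
Proof.
by rewrite mule_ge0 ?ball_sum_ge0 ?mean_fraction_ge0// => ?; exact: mean_weight_ge0.
Qed.

Let measurable_transported n : measurable_fun setT (transported n).
Proof.
apply: emeasurable_funM; first exact: measurable_mean_fraction.
by apply: measurable_ball_sum;
  [exact: mean_weight_ge0|exact: measurable_mean_weight].
Qed.

(* Each point x sends the mass mean_weight x * mean_fraction y to every point y
   at distance less than n, that is at most mean_weight x altogether. *)
Lemma integral_transported n :
  \int[mu]_c transported n c <= expected_root_weight P mu w1.
Proof.
rewrite expected_root_weightE// /transported (mass_transport hmu); first last.
- exact: measurable_mean_weight.
- exact: measurable_mean_fraction.
- exact: mean_weight_ge0.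
- exact: mean_fraction_ge0.
have m0 := mean_weight_ge0 P w1.
have q0 := mean_fraction_ge0 P w2 n%:R.
apply: ge0_le_integral => //.
- by move=> c _; rewrite mule_ge0// ball_sum_ge0.
- apply: emeasurable_funM; first exact: measurable_mean_weight.
  by apply: measurable_ball_sum => //; exact: measurable_mean_fraction.
- exact: measurable_mean_weight.
- by move=> c _; rewrite -[leRHS]mule1 lee_wpmul2l// ball_sum_mean_fraction_le1.
Qed.

Lemma ae_liminf_transported : expected_root_weight P mu w1 < +oo ->
  {ae mu, forall c, forall v : dspace c,
    mean_weight P w1 (pointed v) < +oo /\
    limn_einf (transported ^~ (pointed v)) < +oo}.
Proof.
move=> w1oo.
have H1 : {ae mu, forall c, forall v : dspace c, mean_weight P w1 (pointed v) < +oo}.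
  have m0 := mean_weight_ge0 P w1; have mm := measurable_mean_weight hw1.
  apply: (ae_all_points hmu) => //; apply: ae_lty => //.
  by rewrite -expected_root_weightE.
have J0 c : 0 <= limn_einf (transported ^~ c) by exact: limn_einf_ge0.
have mJ : measurable_fun setT (fun c => limn_einf (transported ^~ c)).
  apply: measurableT_comp => //.
  apply: (measurable_fun_limn_esup (f := fun n c => - transported n c)) => n.
  by apply: measurableT_comp => //; exact: measurable_transported.
have H2 : {ae mu, forall c, forall v : dspace c,
    limn_einf (transported ^~ (pointed v)) < +oo}.
  apply: (ae_all_points hmu (f := fun c => limn_einf (transported ^~ c))) => //.
  apply: ae_lty => //; apply: le_lt_trans (fatou _ _ _ _) _ => //.
  apply: le_lt_trans w1oo; apply: limn_einf_le_frequently => N.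
  by exists N => //; exact: integral_transported.
by apply: filterS2 H1 H2 => c h1 h2 v; split.
Qed.

Lemma ae_domination (D : discreteSpace R) (v : D) :
  (forall u : D, mean_weight P w1 (pointed u) < +oo) ->
  limn_einf (transported ^~ (pointed v)) < +oo ->
  {ae P D, forall omega, exists M : R, forall N, exists2 n, (N <= n)%N &
    (w2 omega v * wsum (w1 omega) n%:R v <= M * wsum (w2 omega) (n%:R + n%:R) v)%R}.
Proof.
move=> moo Joo.
pose a n := ball_sum (mean_weight P w1) n%:R (prepr (pointed v)).
have a0 n : 0 <= a n by apply: ball_sum_ge0 => ?; exact: mean_weight_ge0.
have afin n : a n \is a fin_num.
  rewrite ge0_fin_numE// /a (ball_sum_isometric _ _ (prepr_pclass_of _)) /ball_sum.
  rewrite (esum_enum v)//; last 2 first.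
  - exact: finite_oball.
  - by move=> u _; exact: mean_weight_ge0.
  by apply: lte_sum_pinfty => i _; rewrite pointed_reroot.
pose A n : R := (1 + fine (a n))%R.
have A1 n : (1 <= A n)%R by rewrite lerDl fine_ge0.
have A0 n : (0 < A n)%R by exact: lt_le_trans (A1 n).
pose f n (omega : Omega D) : \bar R :=
  ((A n)^-1 * wsum (w1 omega) n%:R v)%:E +
  (A n)%:E * (w2 omega v / wsum (w2 omega) (n%:R + n%:R) v)%:E.
have fr0 n omega : (0 <= w2 omega v / wsum (w2 omega) (n%:R + n%:R) v)%R.
  by rewrite divr_ge0// wsum_ge0.
have s0 n omega : (0 <= (A n)^-1 * wsum (w1 omega) n%:R v)%R.
  by rewrite mulr_ge0 ?wsum_ge0// invr_ge0 ltW.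
have mf1 n : measurable_fun setT
    (fun omega : Omega D => ((A n)^-1 * wsum (w1 omega) n%:R v)%:E).
  apply/measurable_EFinP; apply: measurable_funM => //.
  exact: (measurable_wsum hw1).
have mf2 n := measurable_fraction hw2 (n%:R + n%:R) v.
have f0 n omega : 0 <= f n omega.
  by rewrite adde_ge0// ?mule_ge0// lee_fin// ltW.
have mf n : measurable_fun setT (f n).
  by apply: emeasurable_funD => //; apply: emeasurable_funM.
have If n : \int[P D]_omega f n omega <= 2%:E + transported n (pointed v).
  rewrite ge0_integralD//; first last.
  - exact: emeasurable_funM.
  - by move=> omega _; rewrite mule_ge0// lee_fin// ltW.
  - by move=> omega _; rewrite lee_fin.
  under eq_integral do rewrite EFinM.
  rewrite ge0_integralZl//; first last.
  - by rewrite lee_fin invr_ge0 ltW.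
  - by move=> omega _; rewrite lee_fin wsum_ge0.
  - by apply/measurable_EFinP; exact: (measurable_wsum hw1).
  rewrite ge0_integralZl//; first last.
  - by rewrite lee_fin ltW.
  - by move=> omega _; rewrite lee_fin.
  rewrite integral_wsum// -mean_fraction_pointed// -/(a n).
  set q := mean_fraction _ _ _ _.
  have q0 : 0 <= q by exact: mean_fraction_ge0.
  have q1 : q <= 1 by exact: mean_fraction_le1.
  rewrite (_ : transported n (pointed v) = q * a n)//.
  rewrite (_ : 2%:E = 1 + 1 :> \bar R)// -addeA leeD//.
    rewrite -(fineK (afin n)) -EFinM lee_fin mulrC ler_pdivrMr// mul1r.
    by rewrite /A lerDr.
  rewrite /A EFinD fineK// ge0_muleDl// ?mul1e ?lee01//.
  by rewrite muleC leeD// muleC.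
have Ioo : \int[P D]_omega limn_einf (f ^~ omega) < +oo.
  apply: le_lt_trans (fatou _ _ _ _) _ => //.
  have [r [Jr _]] := ereal_between Joo.
  apply: (@le_lt_trans _ _ (2%:E + r%:E)); last by rewrite ltry.
  apply: limn_einf_le_frequently => N.
  have [n Nn nr] := limn_einf_lt_frequently Jr N.
  by exists n => //; apply: le_trans (If n) _; rewrite leeD2l// ltW.
have : {ae P D, forall omega, limn_einf (f ^~ omega) < +oo}.
  apply: ae_lty => //; first by move=> omega; exact: limn_einf_ge0.
  apply: measurableT_comp => //.
  apply: (measurable_fun_limn_esup (f := fun n omega => - f n omega)) => n.
  by apply: measurableT_comp.
apply: filterS => omega /ereal_between[r [fr _]]; exists (r * r)%R => N.
have [n Nn fnr] := limn_einf_lt_frequently fr (maxn N 1).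
exists n; first by apply: leq_trans Nn; exact: leq_maxl.
have n0 : (0 < n)%N by apply: leq_trans Nn; exact: leq_maxr.
have : (w2 omega v <= wsum (w2 omega) (n%:R + n%:R) v)%R.
  by apply: wsum_ge => //; rewrite mdistxx addr_gt0// ltr0n.
move: fnr; rewrite /f -EFinM -EFinD lte_fin.
have := fr0 n omega; have := s0 n omega.
set s1 := wsum (w1 omega) _ _; set s2 := wsum (w2 omega) _ _.
have s20 : (0 <= s2)%R by exact: wsum_ge0.
set x := ((A n)^-1 * s1)%R; set y := (w2 omega v / s2)%R => x0 y0 xyr ws2.
have Ay0 : (0 <= A n * y)%R by rewrite mulr_ge0// ltW.
have -> : (w2 omega v * s1 = x * (A n * y) * s2)%R.
  have [s2E|s2N] := eqVneq s2 0%R.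
    have -> : w2 omega v = 0%R by apply/eqP; rewrite eq_le w20 andbT -s2E.
    by rewrite s2E mul0r mulr0.
  rewrite /x /y; field.
  by rewrite s2N gt_eqF.
by rewrite ler_wpM2r// ler_pM//; lra.
Qed.

End comparison.

Lemma ae_forall_points (R : realType) (D : discreteSpace R) (o : D) d
    (T : measurableType d) (m : {measure set T -> \bar R}) (Q : D -> T -> Prop) :
  (forall v, {ae m, forall x, Q v x}) -> {ae m, forall x, forall v, Q v x}.
Proof.
move=> mQ; pose e k i := nth o (finmap.enum_fset (fset_set (oball k%:R o))) i.
have := ae_foralln (fun k => ae_foralln (fun i => mQ (e k i))).
apply: filterS => x H v; pose k := (Num.truncn (mdist o v)).+1.
have vk : v \in finmap.enum_fset (fset_set (oball k%:R o)).
  by rewrite in_fset_set; [rewrite inE /oball/= truncnS_gt|exact: finite_oball].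
have := H k (index v (finmap.enum_fset (fset_set (oball k%:R o)))).
by rewrite /e nth_index.
Qed.

Section ball_weights.
Context (R : realType) (D : discreteSpace R) (m : D -> R) (o v : D).
Hypothesis m0 : forall u, 0 <= m u.

Lemma finite_Nball r : finite_set (Nball r o).
Proof. by apply: sub_finite_set (finite_closed_ball o r) => u []. Qed.

Definition closed_wsum (r : R) : R := fine (\esum_(u in Nball r o) (m u)%:E).

Lemma closed_wsumE r : (closed_wsum r)%:E = \esum_(u in Nball r o) (m u)%:E.
Proof.
rewrite /closed_wsum (esum_enum o).
- by rewrite fineK//; apply/sum_fin_numP.
- exact: finite_Nball.
- by move=> u _; rewrite lee_fin.
Qed.

Lemma closed_wsum_le r s : mdist o v + r < s -> closed_wsum r <= wsum m s v.
Proof.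
move=> rs; rewrite -lee_fin closed_wsumE wsumE//.
apply: esum_subset => [u [_ ur]|u _]; last by rewrite lee_fin.
rewrite /oball/=; apply: le_lt_trans (metric_triangle _ o _) _.
by apply: le_lt_trans rs; rewrite metric_sym lerD2l.
Qed.

Lemma le_closed_wsum r s : 0 < s -> mdist o v + r <= s ->
  wsum m r v <= closed_wsum s.
Proof.
move=> s0 rs; rewrite -lee_fin closed_wsumE wsumE//.
apply: esum_subset => [u|u _]; last by rewrite lee_fin.
rewrite /oball/= => ur; split=> //; apply: le_trans (metric_triangle _ v _) _.
by apply: le_trans rs; rewrite lerD2l ltW.
Qed.

End ball_weights.

Lemma growth_le_of_domination (R : realType) (D : discreteSpace R) (o v : D)
    (m1 m2 : D -> R) (M : R) : (forall u, 0 <= m1 u) -> (forall u, 0 <= m2 u) ->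
  0 < m2 v ->
  (forall N, exists2 n, (N <= n)%N &
    m2 v * wsum m1 n%:R v <= M * wsum m2 (n%:R + n%:R) v) ->
  (lower_growth (fun r => \esum_(u in Nball r o) (m1 u)%:E) <=
   upper_growth (fun r => \esum_(u in Nball r o) (m2 u)%:E))%E.
Proof.
move=> m10 m20 m2v H.
under eq_fun do rewrite -closed_wsumE//.
under [X in (_ <= upper_growth X)%E]eq_fun do rewrite -closed_wsumE//.
apply: (@growth_le _ _ _ (Num.max M 1 / m2 v) (m2 v)) => //.
  by rewrite divr_gt0// lt_max ltr01 orbT.
move=> B; set dl := mdist o v.
have dl0 : 0 <= dl by exact: mdist_ge0.
pose N := (Num.truncn (`|B| + 5 * dl + 5)).+1.
have [n Nn Hn] := H N.
have nB : `|B| + 5 * dl + 5 < n%:R.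
  by apply: lt_le_trans (truncnS_gt _) _; rewrite ler_nat.
have BB := ler_norm B; have B0 := normr_ge0 B.
have n0 : 0 < n%:R :> R by lra.
have f2 : wsum m2 (n%:R + n%:R) v <= closed_wsum m2 o (n%:R + n%:R + dl).
  by apply: le_closed_wsum => //; rewrite -/dl; lra.
have m2f : m2 v <= wsum m2 (n%:R + n%:R) v.
  by apply: wsum_ge => //; rewrite mdistxx; lra.
exists (n%:R - dl - 1), (n%:R + n%:R + dl); split; [lra|lra|lra| |].
  exact: le_trans f2.
have f1 : closed_wsum m1 o (n%:R - dl - 1) <= wsum m1 n%:R v.
  by apply: closed_wsum_le => //; rewrite -/dl; lra.
rewrite mulrAC ler_pdivlMr// mulrC.
apply: (@le_trans _ _ (m2 v * wsum m1 n%:R v)); first by rewrite ler_wpM2l// ltW.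
apply: le_trans Hn _; apply: (@le_trans _ _ (Num.max M 1 * wsum m2 (n%:R + n%:R) v)).
  by rewrite ler_wpM2r ?wsum_ge0// le_max lexx.
by rewrite ler_wpM2l// le_max ler01 orbT.
Qed.

Lemma ae_lower_growth_le_upper_growth (R : realType) (mu : probability (Dstar R) R)
    (hmu : unimodular mu)
    (d : discreteSpace R -> measure_display)
    (Omega : forall D : discreteSpace R, measurableType (d D))
    (P : forall D : discreteSpace R, probability (Omega D) R)
    (w1 w2 : forall D : discreteSpace R, Omega D -> D -> R)
    (hw1 : equivariant_weight P w1) (hw2 : equivariant_weight P w2) :
  (expected_root_weight P mu w1 < +oo)%E -> nondegenerate_weight P mu w2 ->
  almost_surely P mu (fun c omega =>
    (lower_growth (ball_weight w1 omega) <=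
     upper_growth (ball_weight w2 omega))%E).
Proof.
move=> w1oo; apply: filterS2 (ae_liminf_transported hmu hw1 hw2 w1oo) => c H.
have := ae_forall_points (droot c) (fun v =>
  ae_domination hw1 hw2 (fun u => (H u).1) (H v).2).
apply: filterS2 => omega dom [v v0]; have [M HM] := dom v.
apply: (growth_le_of_domination (droot c) _ _ _ HM).
- by move=> u; case: hw1.
- by move=> u; case: hw2.
- by rewrite lt0r v0/=; case: hw2 => _; apply.
Qed.

Theorem theorem2p17 (R : realType) (mu : probability (Dstar R) R)
    (hmu : unimodular mu)
    (d : discreteSpace R -> measure_display)
    (Omega : forall D : discreteSpace R, measurableType (d D))
    (P : forall D : discreteSpace R, probability (Omega D) R)
    (w1 w2 : forall D : discreteSpace R, Omega D -> D -> R)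
    (hw1 : equivariant_weight P w1) (hw2 : equivariant_weight P w2) :
  ((expected_root_weight P mu w1 < +oo)%E -> nondegenerate_weight P mu w2 ->
    almost_surely P mu (fun c omega =>
      (lower_growth (ball_weight w1 omega) <=
       upper_growth (ball_weight w2 omega))%E)) /\
  ((expected_root_weight P mu w1 < +oo)%E ->
   (expected_root_weight P mu w2 < +oo)%E ->
   nondegenerate_weight P mu w1 -> nondegenerate_weight P mu w2 ->
    almost_surely P mu (fun c omega =>
      growth_well_defined (ball_weight w1 omega) ->
      growth_well_defined (ball_weight w2 omega) ->
      upper_growth (ball_weight w1 omega) =
      upper_growth (ball_weight w2 omega))).
Proof.
have main := ae_lower_growth_le_upper_growth hmu.
split=> [|w1oo w2oo n1 n2]; first exact: main.
apply: filterS2 (main _ _ _ _ _ hw1 hw2 w1oo n2) (main _ _ _ _ _ hw2 hw1 w2oo n1).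
move=> c; apply: filterS2 => omega le12 le21 g1 g2.
by apply/eqP; rewrite eq_le -{1}g1 le12 -g2 le21.
Qed.
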